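(* Let $k$ be a field of characteristic $0$, let $n\ge1$ be an integer, and let $x_1,\dots,x_n$ be independent variables over $k$. Then $$k(X)_0^G=k\bigl(q_r \mid 1\le r\le n(n-1)/2\bigr).$$
   Context: $X=(x_1,\dots,x_n)$. $k(X)_0\subset k(x_1,\dots,x_n)$ is the field of rational functions of total degree $0$, i.e. quotients of homogeneous polynomials of the same degree; equivalently, the subfield generated over $k$ by the ratios $x_i/x_j$. The symmetric group $S_n$ acts on $k(X)_0$ by permuting $x_1,\dots,x_n$; the group $T=\{1,\tau\}$ of order two acts by the $k$-automorphism $\tau(x_i)=x_i^{-1}$ for all $i$. These actions commute, so $G:=S_n\times T$ acts on $k(X)_0$, and $k(X)_0^G$ is the field of invariants. For an integer $r$, $$q_r:=\sum_{i,j=1}^n\left(\frac{x_i}{x_j}\right)^r .$$ *)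

(* Defs.v *)
From HB Require Import structures.
From mathcomp Require Import all_boot all_order all_algebra all_fingroup.
From mathcomp Require Import generic_quotient mpoly.

Set Implicit Arguments.
Unset Strict Implicit.
Unset Printing Implicit Defensive.

Import GRing.Theory.
Local Open Scope ring_scope.

Section FractionMap.

Variables (D : idomainType) (F : fieldType).

(* The extension of phi : D -> F to the fraction field.  It does not depend on
   the chosen representative n / d when phi is an injective ring morphism. *)
Definition fracmap (phi : D -> F) (f : {fraction D}) : F :=
  phi \n_(repr f) / phi \d_(repr f).

Lemma tofrac_div_repr (f : {fraction D}) :
  f = tofrac \n_(repr f) / tofrac \d_(repr f).
Proof.
elim/quotW: f => r; set s := repr _.
have ds0 : tofrac \d_s != 0 by rewrite tofrac_eq0 denom_ratioP.
apply: (mulIf ds0); rewrite divfK //.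
have -> : (\pi r : {fraction D})%qT = (\pi s)%qT by rewrite /s reprK.
unlock tofrac; rewrite -[LHS]FracField.pi_mul; apply/eqmodP => /=.
rewrite FracField.equivfE /FracField.mulf !numden_Ratio ?mulf_neq0 ?oner_eq0 //.
  by rewrite !mulr1 mulrC.
all: exact: denom_ratioP.
Qed.

Variable phi : {rmorphism D -> F}.
Hypothesis phi_inj : injective phi.

Lemma fracmap_div a b : b != 0 ->
  fracmap phi (tofrac a / tofrac b) = phi a / phi b.
Proof.
move=> b0; set f := _ / _; rewrite /fracmap.
have [d0 fb0] : \d_(repr f) != 0 /\ tofrac b != 0 by rewrite tofrac_eq0.
have fd0 : tofrac \d_(repr f) != 0 by rewrite tofrac_eq0.
have nz c : c != 0 -> phi c != 0 by rewrite raddf_eq0.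
apply/eqP; rewrite eqr_div ?nz // -!rmorphM (inj_eq phi_inj).
by rewrite -tofrac_eq !rmorphM -eqr_div // -tofrac_div_repr.
Qed.

Lemma fracmap_tofrac a : fracmap phi (tofrac a) = phi a.
Proof.
by rewrite -[tofrac a]divr1 -(rmorph1 (@tofrac D)) fracmap_div ?oner_eq0 // rmorph1 divr1.
Qed.

Lemma fracmap_zmod_morphism : zmod_morphism (fracmap phi).
Proof.
move=> f g; rewrite [f]tofrac_div_repr [g]tofrac_div_repr.
move: \n_(repr f) \d_(repr f) (denom_ratioP (repr f)) => a b b0.
move: \n_(repr g) \d_(repr g) (denom_ratioP (repr g)) => c d d0.
have nz e : e != 0 -> phi e != 0 by rewrite raddf_eq0.
have nzF (e : D) : e != 0 -> tofrac e != 0 by rewrite tofrac_eq0.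
rewrite -mulNr addf_div ?nzF // -rmorphN -!rmorphM -rmorphD.
rewrite !fracmap_div ?mulf_neq0 //.
by rewrite -[- (phi c / _)]mulNr addf_div ?nz // -rmorphN -!rmorphM -rmorphD.
Qed.

Lemma fracmap_monoid_morphism : monoid_morphism (fracmap phi).
Proof.
split=> [|f g].
  by rewrite -(rmorph1 (@tofrac D)) fracmap_tofrac rmorph1.
rewrite [f]tofrac_div_repr [g]tofrac_div_repr.
rewrite mulf_div -!rmorphM !fracmap_div ?mulf_neq0 ?denom_ratioP // !rmorphM /=.
by rewrite mulf_div.
Qed.

End FractionMap.

Section GeneratedSubfield.

Variables (k F : fieldType).

Record is_subfield (L : F -> Prop) : Prop := IsSubfield {
  subfield1 : L 1;
  subfieldB : forall x y, L x -> L y -> L (x - y);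
  subfieldM : forall x y, L x -> L y -> L (x * y);
  subfieldV : forall x, L x -> L x^-1
}.

(* k(S), where k is embedded in F by iota *)
Definition field_gen (iota : k -> F) (S : F -> Prop) (f : F) : Prop :=
  forall L : F -> Prop, is_subfield L ->
    (forall c, L (iota c)) -> (forall s, S s -> L s) -> L f.

End GeneratedSubfield.

Section RationalFunctions.

Variables (n : nat) (k : fieldType).

Notation kX := {fraction {mpoly k[n]}}.

Definition ratC (c : k) : kX := tofrac c%:MP.
Definition ratX (i : 'I_n) : kX := tofrac 'X_i.

Definition ratdeg0 (f : kX) : Prop :=
  exists (d : nat) (p q : {mpoly k[n]}),
    [/\ p \is d.-homog, q \is d.-homog, q != 0 & f = tofrac p / tofrac q].

Definition polysubst (v : 'I_n -> kX) : {mpoly k[n]} -> kX :=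
  mmap (@tofrac {mpoly k[n]} \o @mpolyC n k) v.

Definition perm_act (s : 'S_n) : kX -> kX :=
  fracmap (polysubst (fun i => ratX (s i))).

Definition tau : kX -> kX := fracmap (polysubst (fun i => (ratX i)^-1)).

Lemma ratX_neq0 i : ratX i != 0.
Proof. by rewrite tofrac_eq0 -msupp_eq0 msuppX. Qed.

Lemma polysubst_perm (s : 'S_n) p :
  polysubst (fun i => ratX (s i)) p = tofrac (msym s p).
Proof.
rewrite /polysubst /msym /mmap raddf_sum /=; apply: eq_bigr => m _.
rewrite /mmap1 rmorphM rmorph_prod; congr (_ * _).
by apply: eq_bigr => i _; rewrite rmorphXn.
Qed.

Lemma polysubst_perm_inj (s : 'S_n) : injective (polysubst (fun i => ratX (s i))).
Proof.
move=> p q; rewrite !polysubst_perm => /eqP; rewrite tofrac_eq => /eqP.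
exact: inj_msym.
Qed.

Lemma polysubst_inv_inj : injective (polysubst (fun i => (ratX i)^-1)).
Proof.
apply: raddf_inj => p p0; apply/eqP/contraT => nz_p.
pose N : 'X_{1..n} := [multinom msize p | i < n].
have leN m : m \in msupp p -> (m <= N)%MM.
  move=> /msize_mdeg_lt mp; apply/mnm_lepP => i; rewrite mnmE.
  apply: leq_trans (ltnW mp); rewrite mdegE (bigD1 i) //=; exact: leq_addr.
pose q := \sum_(m <- msupp p) p@_m *: 'X_[k, (N - m)%MM].
have q0 : q = 0.
  apply/eqP; rewrite -tofrac_eq0; apply/eqP.
  rewrite -[RHS](mul0r (tofrac 'X_[N])) -p0 /polysubst /mmap mulr_suml /q.
  rewrite raddf_sum /= big_seq [RHS]big_seq; apply: eq_bigr => m mp.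
  rewrite -mul_mpolyC rmorphM /= -mulrA; congr (_ * _).
  rewrite -{2}(submK (leN _ mp)) mpolyXD rmorphM /= mulrC -mulrA.
  rewrite [X in _ * X](_ : _ = 1) ?mulr1 //.
  rewrite [in X in X * _]mpolyXE_id rmorph_prod /mmap1 -big_split /=.
  rewrite big1 // => i _; rewrite rmorphXn exprVn mulfV //.
  by rewrite expf_neq0 ?ratX_neq0.
have [m mp] : exists m, m \in msupp p.
  case E : (msupp p) => [|m s]; last by exists m; rewrite inE eqxx.
  by move: nz_p; rewrite -msupp_eq0 E.
have : q@_(N - m) = p@_m.
  rewrite /q raddf_sum /= (bigD1_seq m) ?msupp_uniq //= mcoeffZ mcoeffX eqxx.
  rewrite mulr1 big_seq_cond big1 ?addr0 // => m' /andP [m'p m'm].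
  rewrite mcoeffZ mcoeffX; case: eqP => [E|_]; last by rewrite mulr0.
  case/eqP: m'm; apply: (@addmI _ (N - m)%MM).
  by rewrite submK ?leN // -E submK ?leN.
by rewrite q0 mcoeff0 => /esym/eqP; move: mp; rewrite mcoeff_msupp => /negPf ->.
Qed.

HB.instance Definition _ s := GRing.isZmodMorphism.Build kX kX (perm_act s)
  (fracmap_zmod_morphism (@polysubst_perm_inj s)).
HB.instance Definition _ s := GRing.isMonoidMorphism.Build kX kX (perm_act s)
  (fracmap_monoid_morphism (@polysubst_perm_inj s)).
HB.instance Definition _ := GRing.isZmodMorphism.Build kX kX tau
  (fracmap_zmod_morphism polysubst_inv_inj).
HB.instance Definition _ := GRing.isMonoidMorphism.Build kX kX tau
  (fracmap_monoid_morphism polysubst_inv_inj).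

Lemma perm_actC s c : perm_act s (ratC c) = ratC c.
Proof.
rewrite /perm_act fracmap_tofrac; last exact: polysubst_perm_inj.
by rewrite /polysubst /= mmapC.
Qed.

Lemma perm_actX s i : perm_act s (ratX i) = ratX (s i).
Proof.
rewrite /perm_act fracmap_tofrac; last exact: polysubst_perm_inj.
by rewrite /polysubst /= mmapX mmap1U.
Qed.

Lemma tauC c : tau (ratC c) = ratC c.
Proof.
rewrite /tau fracmap_tofrac; last exact: polysubst_inv_inj.
by rewrite /polysubst /= mmapC.
Qed.

Lemma tauX i : tau (ratX i) = (ratX i)^-1.
Proof.
rewrite /tau fracmap_tofrac; last exact: polysubst_inv_inj.
by rewrite /polysubst /= mmapX mmap1U.
Qed.

Lemma ratfun_morph_eq (f g : {rmorphism kX -> kX}) :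
  (forall c, f (ratC c) = g (ratC c)) -> (forall i, f (ratX i) = g (ratX i)) ->
  f =1 g.
Proof.
move=> eqC eqX.
have eqP p : f (tofrac p) = g (tofrac p).
  elim/mpolyind: p => [|c m p _ _ IH]; first by rewrite !rmorph0.
  rewrite !rmorphD IH -mul_mpolyC !rmorphM /=; congr (_ * _ + _).
    exact: eqC.
  rewrite mpolyXE_id !rmorph_prod; apply: eq_bigr => i _.
  by rewrite !rmorphXn; congr (_ ^+ _); apply: eqX.
by move=> x; rewrite [x]tofrac_div_repr !fmorph_div !eqP.
Qed.

Lemma perm_act1 : perm_act 1%g =1 id.
Proof.
apply: (@ratfun_morph_eq (perm_act 1%g) idfun) => [c|i]; first exact: perm_actC.
by rewrite /= perm_actX perm1.
Qed.

Lemma perm_actM s t : perm_act (s * t)%g =1 perm_act t \o perm_act s.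
Proof.
apply: (@ratfun_morph_eq _ (perm_act t \o perm_act s)) => [c|i] /=.
  by rewrite !perm_actC.
by rewrite !perm_actX permM.
Qed.

Lemma tauK : involutive tau.
Proof.
apply: (@ratfun_morph_eq (tau \o tau) idfun) => [c|i] /=; first by rewrite !tauC.
by rewrite tauX fmorphV /= tauX invrK.
Qed.

Lemma perm_act_tau s : perm_act s \o tau =1 tau \o perm_act s.
Proof.
apply: (@ratfun_morph_eq (perm_act s \o tau) (tau \o perm_act s)) => [c|i] /=.
  by rewrite !(perm_actC, tauC).
by rewrite perm_actX !tauX fmorphV /= perm_actX.
Qed.

(* T is realised as 'Z_2, with tau as the element 1 of the ring 'Z_2. *)
Definition Gact (f : kX) (g : 'S_n * 'Z_2) : kX := iter g.2 tau (perm_act g.1 f).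

Lemma Gact1 : Gact^~ 1%g =1 id.
Proof. exact: perm_act1. Qed.

Lemma GactM f : act_morph Gact f.
Proof.
have iter_odd m x : iter m tau x = if odd m then tau x else x.
  by elim: m => //= m ->; case: (odd m); rewrite /= ?tauK.
move=> [s a] [t b]; rewrite /Gact /= perm_actM /= !iter_odd /=.
rewrite [odd _](_ : _ = odd a (+) odd b); last first.
  by case: a b => [[|[|a]] //= ?] [[|[|b]] //= ?].
case: (odd a); case: (odd b) => //=.
- by rewrite -[perm_act t (tau _)]/((perm_act t \o tau) _) perm_act_tau /= tauK.
- by rewrite -[perm_act t (tau _)]/((perm_act t \o tau) _) perm_act_tau.
Qed.

Canonical Gaction : {action 'S_n * 'Z_2 &-> kX} := TotalAction Gact1 GactM.

(* k(X)_0^G *)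
Definition ratdeg0_inv (f : kX) : Prop :=
  ratdeg0 f /\ forall g : 'S_n * 'Z_2, Gaction f g = f.

Definition q_ (r : int) : kX :=
  \sum_(i < n) \sum_(j < n) (ratX i / ratX j) ^ r.

End RationalFunctions.

Arguments ratC {n k}.
Arguments q_ {n k}.

(* Main.v *)
From HB Require Import structures.
From mathcomp Require Import all_boot all_order all_algebra all_fingroup all_field.
From mathcomp Require Import boolp zify ring.
From mathcomp Require Import mpoly.
Require Import Defs.
Set Implicit Arguments.
Unset Strict Implicit.
Unset Printing Implicit Defensive.
Import GRing.Theory.
Local Open Scope ring_scope.

(** Write K for the field generated by the q_r with 1 <= r <= N = n(n-1)/2 and
    X_i for the variables.  The q_r are visibly invariant of degree 0, so the
    point is that an invariant f lies in K.

    The 2N ratios X_a / X_b, a != b, come in pairs z, z^-1, and q_r - n is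
    their r-th power sum.  By Newton's identities, which need characteristic
    0, the power sums of exponent at most N put the lower half of the
    coefficients of P = \prod_(a != b) (Y - X_a / X_b) in K; P is palindromic
    because its roots are stable under inversion, so the other half follows
    (reciprocal_poly_subfield).  Hence the ratios, which generate k(X)_0, are
    exactly the roots of a polynomial over K.

    It remains to see that the Galois group of k(X)_0 over K is induced by
    G = S_n x T.  A K-conjugation permutes the ratios and keeps their
    multiplicative relations, so it acts on the root system of type A_(n-1)
    by an automorphism, and these are the permutations and their negatives.
    Concretely, for fixed i0 let X_i0 / X_i go to X_(a i) / X_(b i).  For
    i != j the quotient of two such images is again a ratio, which forces
    exactly one of a i = a j and b i = b j (ratX_ratio_xor); points of a grid
    any two of which lie on a common line all lie on one line (grid_lines).
    So a or b is constant, and the conjugation is a permutation of the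
    variables, composed with tau in the second case (ratio_system).

    No Galois extension is constructed.  If x is a primitive element of K(ratios)
    with minimal polynomial m over K, an irreducible factor q of m over
    L = k(X) gives the embedding x |-> Y of K(x) into L[Y]/(q).
    The relation conj_mod records the pairs (u, v) in which the image of u is
    the constant v.  If f is fixed by all these conjugations and f = g(x) with
    deg g < deg m, then every q divides g - f; as m is separable, m divides
    g - f, so g is the constant f (galois_descent). *)

(** * Subfields as field types *)

Lemma field_gen_subfield (k F : fieldType) (iota : k -> F) (S : F -> Prop) :
  is_subfield (field_gen iota S).
Proof.
split=> [L sL _ _|x y Sx Sy L sL L_C LS|x y Sx Sy L sL L_C LS|x Sx L sL L_C LS].
- exact: subfield1 sL.
- by apply: (subfieldB sL); [apply: Sx | apply: Sy].
- by apply: (subfieldM sL); [apply: Sx | apply: Sy].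
- by apply: (subfieldV sL); apply: Sx.
Qed.

Section SubfieldType.

Variables (F : fieldType) (P : F -> Prop).
Hypothesis subP : is_subfield P.

(** The closure proof is an argument so that the predicate, and the type below,
    can carry canonical field structures. *)
Definition in_subfield (_ : is_subfield P) : {pred F} := fun x => `[< P x >].

Lemma in_subfieldP x : reflect (P x) (x \in in_subfield subP).
Proof. exact: asboolP. Qed.

Lemma in_subfield_divring_closed : divring_closed (in_subfield subP).
Proof.
split=> [|x y /in_subfieldP Px /in_subfieldP Py|x y /in_subfieldP Px /in_subfieldP Py];
  apply/in_subfieldP.
- exact: subfield1 subP.
- exact: subfieldB.
- by apply: subfieldM => //; apply: subfieldV.
Qed.

HB.instance Definition _ :=
  GRing.isDivringClosed.Build F (in_subfield subP) in_subfield_divring_closed.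

Record subfield_type :=
  Subfield {subfield_val : F; _ : subfield_val \in in_subfield subP}.

HB.instance Definition _ := [isSub for subfield_val].
HB.instance Definition _ := [Choice of subfield_type by <:].
HB.instance Definition _ :=
  [SubChoice_isSubIntegralDomain of subfield_type by <:].
HB.instance Definition _ :=
  [SubIntegralDomain_isSubField of subfield_type by <:].

Lemma subfield_valP (c : subfield_type) : P (val c).
Proof. exact/in_subfieldP/(valP c). Qed.

Lemma subfield_polyP (p : {poly F}) :
  (forall i, P p`_i) -> exists q : {poly subfield_type}, map_poly val q = p.
Proof.
move=> Pp; exists (\poly_(i < size p) insubd 0 p`_i).
apply/polyP=> i; rewrite coef_map coef_poly; case: ltnP => [_|le_p]; last first.
  by rewrite nth_default.
by rewrite /= val_insubd ifT //; apply/in_subfieldP.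
Qed.

End SubfieldType.

(** * Conjugations over a base field *)

Section Conjugation.

Variables (K L : fieldType) (iota : {rmorphism K -> L}).

Local Notation "p ^ f" := (map_poly f p) : ring_scope.

(** The graph of a K-isomorphism between two subfields of L, seen as a relation:
    its domain and its codomain need not be computed. *)
Record conjugation (R : L -> L -> Prop) : Prop := Conjugation {
  conj_const : forall c, R (iota c) (iota c);
  conj_sub : forall u u' v v', R u u' -> R v v' -> R (u - v) (u' - v');
  conj_mul : forall u u' v v', R u u' -> R v v' -> R (u * v) (u' * v');
  conj_inv : forall u u', R u u' -> R u^-1 u'^-1;
  conj_zero : forall v, R 0 v -> v = 0
}.

Lemma conj_inj R u v w : conjugation R -> R u v -> R u w -> v = w.
Proof.
move=> cR Ruv Ruw; apply/eqP; rewrite -subr_eq0; apply/eqP/(conj_zero cR).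
by rewrite -(subrr u); apply: (conj_sub cR).
Qed.

Lemma conj_root R (p : {poly K}) u v :
  conjugation R -> R u v -> root (p ^ iota) u -> root (p ^ iota) v.
Proof.
move=> cR Ruv /eqP pu0; apply/eqP/(conj_zero cR); rewrite -{}pu0.
elim/poly_ind: p => [|p c IH].
  by rewrite rmorph0 !horner0; have := conj_const cR 0; rewrite rmorph0.
rewrite rmorphD rmorphM /= map_polyX map_polyC !hornerMXaddC /=.
have cN : R (iota (- c)) (iota (- c)) by apply: conj_const.
by rewrite -[iota c]opprK -rmorphN; apply: (conj_sub cR) => //; apply: (conj_mul cR).
Qed.

Lemma minimal_polynomial (x : L) : algebraicOver iota x ->
  exists m : {poly K}, [/\ m != 0, root (m ^ iota) x
    & forall p, root (p ^ iota) x -> m %| p].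
Proof.
case=> p0 nz_p0 p0x.
pose Q d := `[< exists p : {poly K}, [/\ p != 0, root (p ^ iota) x & size p = d] >].
have exQ : exists d, Q d by exists (size p0); apply/asboolP; exists p0.
case: (ex_minnP exQ) => d /asboolP[m [nz_m mx <-]] min_m.
exists m; split=> // p px; apply/modp_eq0P/eqP/contraT => nz_r.
suff /min_m : Q (size (p %% m)) by rewrite leqNgt ltn_modp nz_m.
apply/asboolP; exists (p %% m); split=> //.
move: px; rewrite {1}(divp_eq p m) rmorphD rmorphM /= /root hornerD hornerM.
by rewrite (eqP mx) mulr0 add0r.
Qed.

Lemma deriv_neq0_pchar0 (p : {poly K}) :
  [pchar K] =i pred0 -> (1 < size p)%N -> p^`() != 0.
Proof.
move=> /pcharf0P char0 p_gt1; apply/eqP => /(congr1 (fun q : {poly K} => q`_(size p).-2)).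
rewrite coef_deriv coef0 -mulr_natr => /eqP; rewrite mulf_eq0 char0 orbF.
have -> : (size p).-2.+1 = (size p).-1 by case: (size p) p_gt1 => [|[]].
by rewrite -lead_coefE lead_coef_eq0 -size_poly_eq0; case: (size p) p_gt1.
Qed.

(** One of the factors gcd(m, m') and m / gcd(m, m') vanishes at x.  By minimality
    it is not the first, which divides m' != 0 and so has smaller degree; hence
    m divides the second, which is separable. *)
Lemma minimal_separable (x : L) (m : {poly K}) :
    [pchar K] =i pred0 -> m != 0 -> root (m ^ iota) x ->
    (forall p, root (p ^ iota) x -> m %| p) ->
  separable_poly m.
Proof.
move=> char0 nz_m mx min_m; set d := gcdp m m^`().
have Dm : m %/ d * d = m by rewrite divpK ?dvdp_gcdl.
move: (mx); rewrite -{1}Dm rmorphM rootM => /orP[/min_m ms | /min_m md].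
  exact: dvdp_separable ms (make_separable nz_m).
have m_gt1 : (1 < size m)%N.
  by rewrite -(size_map_poly iota) (root_size_gt1 _ mx) ?map_poly_eq0.
have: m %| m^`() by apply: dvdp_trans md (dvdp_gcdr _ _).
move/(dvdp_leq (deriv_neq0_pchar0 char0 m_gt1)).
by rewrite leqNgt lt_size_deriv.
Qed.

Lemma irredp_factor (p : {poly L}) :
  (1 < size p)%N -> exists2 q, irreducible_poly q & q %| p.
Proof.
move=> p_gt1.
pose Q d := `[< exists q : {poly L}, [/\ (1 < size q)%N, q %| p & size q = d] >].
have exQ : exists d, Q d by exists (size p); apply/asboolP; exists p.
have nz_p : p != 0 by rewrite -size_poly_gt0 ltnW.
case: (ex_minnP exQ) => d /asboolP[q [q_gt1 qp <-]] min_q; exists q => //.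
split=> // r r_neq1 rq; rewrite -(dvdp_size_eqp rq).
have nz_q : q != 0 by rewrite -size_poly_gt0 ltnW.
rewrite eqn_leq dvdp_leq //= min_q //; apply/asboolP; exists r; split=> //.
  rewrite ltn_neqAle eq_sym r_neq1 size_poly_gt0.
  by apply: contraNneq nz_q => r0; rewrite -dvd0p -r0.
exact: dvdp_trans qp.
Qed.

Lemma irredp_prime (q a b : {poly L}) :
  irreducible_poly q -> q %| a * b -> q %| a \/ q %| b.
Proof.
move=> q_irr qab; case: (irredp_XsubCP q_irr (dvdp_gcdl q a)).
  by rewrite gcdp_eqp1 => co_qa; right; rewrite -(Gauss_dvdpr b co_qa).
by move=> Dq; left; rewrite -(eqp_dvdl a Dq) dvdp_gcdr.
Qed.

Lemma irredp_dvd_prod (q a : {poly L}) (rs : seq L) :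
    irreducible_poly q -> q %| \prod_(r <- rs) (a - r%:P) ->
  exists r, q %| a - r%:P.
Proof.
move=> q_irr; elim: rs => [|r rs IH].
  by rewrite big_nil dvdp1 => /eqP sq; case: q_irr; rewrite sq.
by rewrite big_cons => /(irredp_prime q_irr)[|/IH//]; exists r.
Qed.

(** Induction with the primitive element theorem for two elements, rewriting the
    earlier generators as polynomials in the new primitive element. *)
Lemma primitive_element (zs : seq L) :
    [pchar K] =i pred0 -> {in zs, forall z, algebraicOver iota z} ->
  exists2 x, algebraicOver iota x
    & {in zs, forall z, exists g, (g ^ iota).[x] = z}.
Proof.
move=> char0; elim: zs => [|z zs IH] alg_zs.
  by exists 0 => //; apply: algebraic0.
have [|y alg_y y_zs] := IH.
  by move=> w ws; apply: alg_zs; rewrite inE ws orbT.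
have alg_z : algebraicOver iota z by apply: alg_zs; rewrite mem_head.
have [[p nz_p pz] [q nz_q qy]] := (alg_z, alg_y).
have [n /= [xz [h hy]]] := pchar0_PET nz_p pz nz_q qy char0.
exists (y *+ n - z); last first.
  move=> w; rewrite inE => /predU1P[-> // | /y_zs[g gw]].
  by exists (g \Po h); rewrite map_comp_poly horner_comp hy.
apply: algebraic_sub => //; rewrite -mulr_natr -(rmorph_nat iota).
by apply: algebraic_mul => //; apply: algebraic_id.
Qed.

Section ConjugationModulo.

Variables (x : L) (m : {poly K}) (q : {poly L}).
Hypotheses (nz_m : m != 0) (mx : root (m ^ iota) x).
Hypothesis min_m : forall p, root (p ^ iota) x -> m %| p.
Hypotheses (q_irr : irreducible_poly q) (q_m : q %| m ^ iota).

(** The embedding x |-> 'X of K(x) into the field L['X]/(q), restricted to the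
    elements whose image is the class of a constant of L. *)
Definition conj_mod (u v : L) : Prop :=
  exists2 g : {poly K}, (g ^ iota).[x] = u & q %| g ^ iota - v%:P.

(** This makes the image of g(x) in L['X]/(q) independent of the choice of g. *)
Lemma vanishing_dvd (g : {poly K}) : (g ^ iota).[x] = 0 -> q %| g ^ iota.
Proof.
by move=> gx0; rewrite (dvdp_trans q_m) // dvdp_map min_m //; apply/eqP.
Qed.

Lemma minimal_coprime (g : {poly K}) : (g ^ iota).[x] != 0 -> coprimep m g.
Proof.
move=> nz_gx; set d := gcdp m g.
have Dm : m %/ d * d = m by rewrite divpK ?dvdp_gcdl.
have nz_d : d != 0 by rewrite gcdp_eq0 negb_and nz_m.
move: (mx); rewrite -{1}Dm rmorphM rootM => /orP[/min_m m_md | dx].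
  have: size m == size (m %/ d) by rewrite dvdp_size_eqp // /eqp m_md divp_dvd ?dvdp_gcdl.
  have := dvdp_leq nz_m (dvdp_gcdl m g); rewrite size_divp // coprimep_def -/d.
  move: nz_d nz_m; rewrite -!size_poly_gt0.
  by move: (size d) (size m) => [|[|a]] [|b] //=; lia.
case/negP: nz_gx; have /dvdpP[h ->] := dvdp_gcdr m g.
by rewrite rmorphM hornerM (eqP dx) mulr0.
Qed.

Lemma irredp_dvd_const (c : L) : (q %| c%:P) = (c == 0).
Proof.
apply/idP/eqP => [|->]; last by rewrite dvdp0.
apply: contraPeq => nz_c /dvdp_leq; rewrite polyC_eq0 size_polyC nz_c.
by move=> /(_ isT); rewrite leqNgt q_irr.
Qed.

(** By vanishing_dvd the witness of conj_mod can be any polynomial expressing u. *)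
Lemma conj_mod_poly (g : {poly K}) v :
  conj_mod (g ^ iota).[x] v -> q %| g ^ iota - v%:P.
Proof.
case=> h hx qh; have := vanishing_dvd (g := g - h).
rewrite rmorphB hornerD hornerN hx subrr => /(_ erefl) qgh.
by rewrite -(subrK (h ^ iota) (g ^ iota)) -addrA dvdp_add.
Qed.

Lemma conj_modP : conjugation conj_mod.
Proof.
split=> [c|u u' v v' [g gu qg] [h hv qh]|u u' v v' [g gu qg] [h hv qh]||].
- by exists c%:P; rewrite map_polyC ?hornerC //= subrr dvdp0.
- exists (g - h); first by rewrite rmorphB hornerD hornerN gu hv.
  by rewrite rmorphB polyCB /= opprD addrACA -opprD dvdp_sub.
- exists (g * h); first by rewrite rmorphM hornerM gu hv.
  rewrite rmorphM polyCM /= -(subrK (g ^ iota * v'%:P) (g ^ iota * h ^ iota)).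
  rewrite -mulrBr -addrA -mulrBl.
  by apply: dvdp_add; [apply: dvdp_mull | apply: dvdp_mulr].
- move=> u u' [g gu qg]; have [u0|nz_u] := eqVneq u 0.
    have: q %| u'%:P.
      rewrite -(subKr (g ^ iota) u'%:P) dvdp_sub //.
      by apply: vanishing_dvd; rewrite gu.
    rewrite irredp_dvd_const => /eqP->; exists 0; last first.
      by rewrite invr0 rmorph0 subr0 dvdp0.
    by rewrite rmorph0 horner0 u0 invr0.
  (* With a * m + b * g = 1, the value of b at x is u^-1. *)
  have /Bezout_eq1_coprimepP[[a b] /= ab1] : coprimep m g.
    by apply: minimal_coprime; rewrite gu.
  have bu1 : (b ^ iota).[x] * u = 1.
    have := congr1 (fun p => (p ^ iota).[x]) ab1.
    rewrite rmorphD !rmorphM rmorph1 /= hornerD !hornerM gu (eqP mx) mulr0 add0r.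
    by rewrite hornerC.
  have qbu : q %| b ^ iota * u'%:P - 1.
    rewrite -(rmorph1 (map_poly iota)) -ab1 rmorphD !rmorphM /= opprD addrCA.
    rewrite -mulrBr dvdp_add ?dvdpNr ?dvdp_mull //.
    by rewrite -dvdpNr opprB.
  have nz_u' : u' != 0.
    apply: contraTneq qbu => ->; rewrite mulr0 sub0r dvdpNr.
    by rewrite irredp_dvd_const oner_eq0.
  exists b; first by apply: (mulIf nz_u); rewrite bu1 mulVf.
  suff -> : b ^ iota - u'^-1%:P = u'^-1%:P * (b ^ iota * u'%:P - 1) by rewrite dvdp_mull.
  by rewrite mulrBr mulr1 mulrCA -polyCM mulVf // mulr1.
- move=> v [g gx qg]; apply/eqP; rewrite -irredp_dvd_const.
  by rewrite -(subKr (g ^ iota) v%:P) dvdp_sub // vanishing_dvd.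
Qed.

End ConjugationModulo.
End Conjugation.

Section Descent.

Variables (K L : fieldType) (iota : {rmorphism K -> L}).

Local Notation "p ^ f" := (map_poly f p) : ring_scope.

(** With x a primitive element of K(zs) and m its minimal polynomial, m is
    separable, so f = g(x) is in K as soon as each irreducible factor q of m
    over L divides g - f, that is, as soon as conj_mod x q relates f to itself.
    All the zs are in the domain of conj_mod x q: their minimal polynomials
    split in L, and an irreducible q that divides a product of factors g - r
    divides one of them.  So no splitting field of m is needed. *)
Lemma galois_descent (zs : seq L) (f : L) :
    [pchar K] =i pred0 ->
    {in zs, forall z, exists (p : {poly K}) (rs : seq L),
       p ^ iota = \prod_(r <- rs) ('X - r%:P) /\ z \in rs} ->
    (forall R, conjugation iota R -> {in zs, forall z, exists v, R z v} -> R f f) ->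
  exists c, f = iota c.
Proof.
move=> char0 zs_roots conj_f.
have [z /zs_roots[p [rs [Dp rs_z]]]|x [p0 nz_p0 p0x] x_zs] :=
    primitive_element (iota := iota) (zs := zs) char0.
  exists p; last by rewrite Dp root_prod_XsubC.
  by rewrite -(map_poly_eq0 iota) Dp monic_neq0 ?monic_prod_XsubC.
have [|m [nz_m mx min_m]] := @minimal_polynomial _ _ iota x; first by exists p0.
have sep_m : separable_poly (m ^ iota).
  by rewrite separable_map (minimal_separable char0 nz_m mx min_m).
have m_gt1 : (1 < size m)%N.
  by rewrite -(size_map_poly iota) (root_size_gt1 _ mx) ?map_poly_eq0.
have conj_ff q : irreducible_poly q -> q %| m ^ iota -> conj_mod iota x q f f.
  move=> q_irr q_m; have cR := conj_modP nz_m mx min_m q_irr q_m.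
  apply: conj_f => // z zs_z; have [g gz] := x_zs z zs_z.
  have [p [rs [Dp rs_z]]] := zs_roots z zs_z.
  suff [v qgv] : exists v, q %| g ^ iota - v%:P by exists v; exists g.
  apply: (irredp_dvd_prod (rs := rs)) => //.
  have -> : \prod_(r <- rs) (g ^ iota - r%:P) = (p \Po g) ^ iota.
    rewrite map_comp_poly Dp rmorph_prod; apply: eq_bigr => r _.
    by rewrite /= comp_polyB comp_polyX comp_polyC.
  apply: (vanishing_dvd min_m q_m); apply/eqP.
  by rewrite map_comp_poly horner_comp gz -/(root _ _) Dp root_prod_XsubC.
have [g gf] : exists2 g : {poly K}, (size g < size m)%N & (g ^ iota).[x] = f.
  have [|q q_irr q_m] := @irredp_factor L (m ^ iota); first by rewrite size_map_poly.
  have [g gf _] := conj_ff q q_irr q_m; exists (g %% m); first by rewrite ltn_modp.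
  rewrite -gf {2}(divp_eq g m) rmorphD rmorphM hornerD hornerM (eqP mx).
  by rewrite mulr0 add0r.
move=> gxf; set h := g ^ iota - f%:P.
have dvd_h q : irreducible_poly q -> q %| m ^ iota -> q %| h.
  move=> q_irr q_m; apply: (conj_mod_poly min_m q_m).
  by rewrite gxf; apply: conj_ff.
have m_h : m ^ iota %| h.
  set d := gcdp (m ^ iota) h.
  have Dm : (m ^ iota) %/ d * d = m ^ iota by rewrite divpK ?dvdp_gcdl.
  have [e_gt1|e_le1] := ltnP 1 (size ((m ^ iota) %/ d)).
    (* A common factor q of m / d and d would be a square factor of m. *)
    have [q q_irr q_e] := irredp_factor e_gt1.
    have q_m : q %| m ^ iota by rewrite -Dm dvdp_mulr.
    have q_d : q %| d by rewrite dvdp_gcd q_m dvd_h.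
    have q_neq1 : size q != 1%N by rewrite gtn_eqF // q_irr.
    have := separable_nosquare sep_m (isT : 1 < 2)%N q_neq1.
    by rewrite -Dm expr2 dvdp_mul.
  have: d %| h by apply: dvdp_gcdr.
  apply: dvdp_trans; rewrite -{1}Dm -[X in _ %| X]mul1r dvdp_mul2r; last first.
    by rewrite gcdp_eq0 negb_and map_poly_eq0 nz_m.
  rewrite dvdp1 eqn_leq e_le1 size_poly_gt0.
  by apply: contraNneq nz_m => e0; rewrite -(map_poly_eq0 iota) -Dm e0 mul0r.
have /eqP : h == 0.
  apply: contraTT m_h => nz_h; rewrite gtNdvdp // size_map_poly.
  rewrite (leq_ltn_trans (size_polyD _ _)) // size_polyN size_map_poly gtn_max gf.
  by rewrite (leq_ltn_trans (size_polyC_leq1 f)).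
move/eqP; rewrite subr_eq0 => /eqP/(congr1 (fun p : {poly L} => p`_0)).
by rewrite coef_map coefC /= => <-; exists g`_0.
Qed.

End Descent.

(** * Power sums and palindromic polynomials *)

Section PowerSums.

Variable F : fieldType.
Implicit Types (zs : seq F) (p : {poly F}).

(** Newton's identities as -Q' = Q * \sum_z z / (1 - z 'X), with the geometric
    series truncated at 'X^n. *)
Lemma newton_mod_Xn zs n : exists T : {poly F},
  \prod_(z <- zs) (1 - z%:P * 'X)
    * \sum_(z <- zs) (z%:P * \sum_(j < n) (z%:P * 'X) ^+ j)
  = - (\prod_(z <- zs) (1 - z%:P * 'X))^`() + 'X^n * T.
Proof.
elim: zs => [|z zs [T IH]].
  by exists 0; rewrite !big_nil mulr0 derivC oppr0 add0r mulr0.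
rewrite !big_cons; set Q := \prod_(z <- zs) _ in IH *.
set S := \sum_(z <- zs) _ in IH *; set s := \sum_(j < n) _.
exists ((1 - z%:P * 'X) * T - z%:P * z%:P ^+ n * Q).
have geom : (1 - z%:P * 'X) * s = 1 - z%:P ^+ n * 'X^n.
  by rewrite -[1 - _ * 'X]opprB mulNr -subrX1 opprB exprMn.
have -> : (1 - z%:P * 'X) * Q * (z%:P * s + S)
        = z%:P * Q * ((1 - z%:P * 'X) * s) + (1 - z%:P * 'X) * (Q * S) by ring.
rewrite geom IH derivM derivB derivM !derivC derivX; ring.
Qed.

Lemma newton_coef zs n :
  let Q := \prod_(z <- zs) (1 - z%:P * 'X) in
  Q`_n.+1 *+ n.+1 = - \sum_(j < n.+1) Q`_(n - j) * \sum_(z <- zs) z ^+ j.+1.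
Proof.
move=> Q; have [T /(congr1 (fun p : {poly F} => p`_n))] := newton_mod_Xn zs n.+1.
rewrite -/Q coefD coefN coef_deriv coefXnM ltnSn addr0 => /esym/eqP.
rewrite eqr_oppLR => /eqP->; congr (- _); rewrite coefMr.
apply: eq_bigr => j _; congr (_ * _); rewrite coef_sum; apply: eq_bigr => z _.
rewrite coefCM exprS; congr (_ * _); rewrite coef_sum (bigD1 j) //= big1 => [|i ij].
  by rewrite exprMn -polyC_exp coefCM coefXn eqxx mulr1 addr0.
rewrite exprMn -polyC_exp coefCM coefXn; case: eqP => [E|]; last by rewrite mulr0.
by case/eqP: ij; apply/val_inj.
Qed.

Variables (P : F -> Prop) (subP : is_subfield P).
Hypothesis char0 : [pchar F] =i pred0.

Lemma newton_subfield zs N :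
    (forall r, (1 <= r <= N)%N -> P (\sum_(z <- zs) z ^+ r)) ->
  forall i, (i <= N)%N -> P (\prod_(z <- zs) (1 - z%:P * 'X))`_i.
Proof.
move=> Pp; set Q := \prod_(z <- zs) _; elim/ltn_ind=> -[|n] IH nN.
  suff -> : Q`_0 = 1 by apply: subfield1.
  rewrite -horner_coef0 horner_prod big1 // => z _.
  by rewrite !hornerE ?mulr0 ?subr0.
apply/(in_subfieldP subP); move/pcharf0P: char0 => nz_nat.
have nz_n : n.+1%:R != 0 :> F by rewrite nz_nat.
rewrite -(mulfK nz_n Q`_n.+1) mulr_natr newton_coef rpred_div ?rpred_nat //.
rewrite rpredN rpred_sum // => j _; rewrite rpredM //; apply/in_subfieldP.
  by apply: IH; lia.
by apply: Pp; rewrite /= (leq_trans (ltn_ord j)).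
Qed.

(** 'X^n * p(1 / 'X), for p of degree at most n. *)
Definition rev_poly n p : {poly F} := \poly_(i < n.+1) p`_(n - i).

Lemma rev_polyMX n p : rev_poly n.+1 (p * 'X) = rev_poly n p.
Proof.
apply/polyP=> i; rewrite !coef_poly coefMX !ltnS; have [le_in|lt_ni] := leqP i n.
  by rewrite leqW // subSn.
have -> : (n.+1 - i = 0)%N by lia.
by rewrite if_same.
Qed.

Lemma rev_poly_size n p : (size p <= n.+1)%N -> rev_poly n.+1 p = rev_poly n p * 'X.
Proof.
move=> sz_p; apply/polyP=> i; rewrite coefMX !coef_poly.
by case: i => [|i] /=; rewrite ?subSS // subn0 nth_default.
Qed.

Lemma rev_polyD n p q : rev_poly n (p + q) = rev_poly n p + rev_poly n q.
Proof.
by apply/polyP=> i; rewrite coefD !coef_poly coefD; case: ifP; rewrite ?addr0.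
Qed.

Lemma rev_polyCM n c p : rev_poly n (c%:P * p) = c%:P * rev_poly n p.
Proof.
by apply/polyP=> i; rewrite coefCM !coef_poly coefCM; case: ifP; rewrite ?mulr0.
Qed.

Definition palindromic n p := (size p <= n.+1)%N /\ rev_poly n p = p.

(** Reversal at degree n + 2 multiplies the reversal of p at degree n by the
    reversal of 'X^2 + c 'X + 1 at degree 2, which is itself. *)
Lemma palindromicM2 n p c :
  palindromic n p -> palindromic n.+2 (('X^2 + c%:P * 'X + 1) * p).
Proof.
case=> sz_p rev_p.
have sz_c : (size ('X^2 + c%:P * 'X + 1 : {poly F})%R <= 3)%N.
  apply/leq_sizeP => -[|[|[|j]]] // _.
  by rewrite !coefD coefXn coefCM coefX coef1 mulr0 !addr0.
split; first by apply: leq_trans (size_polyMleq _ _) _; lia.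
have -> : ('X^2 + c%:P * 'X + 1) * p = p * 'X * 'X + c%:P * (p * 'X) + p by ring.
rewrite !rev_polyD rev_polyCM !rev_polyMX.
by rewrite (rev_poly_size (leqW sz_p)) (rev_poly_size sz_p) rev_p; ring.
Qed.

Lemma palindromic_coef n p i : palindromic n p -> (i <= n)%N -> p`_i = p`_(n - i).
Proof. by case=> _ {1}<- le_in; rewrite coef_poly ltnS le_in. Qed.

(** Reciprocal pairs of roots halve the number of power sums that are needed: Newton's
    identities give the coefficients up to the middle degree, and the
    polynomial is palindromic. *)
Lemma reciprocal_poly_subfield (ds : seq F) :
    {in ds, forall z, z != 0} ->
    (forall r, (1 <= r <= size ds)%N -> P (\sum_(z <- ds) (z ^+ r + z^-1 ^+ r))) ->
  forall i, P (\prod_(z <- ds) (('X - z%:P) * ('X - z^-1%:P)))`_i.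
Proof.
move=> nz_ds Pp; set Q := \prod_(z <- ds) _.
have Q_newton : Q = \prod_(z <- ds ++ map GRing.inv ds) (1 - z%:P * 'X).
  rewrite big_cat /= big_map -big_split /= /Q /=; apply: eq_big_seq => z /nz_ds nz_z.
  have zV1 : z%:P * z^-1%:P = 1 :> {poly F} by rewrite -polyCM mulfV.
  by ring: zV1.
have Q_pal : palindromic (2 * size ds) Q.
  rewrite /Q {Pp Q_newton Q}; elim: ds nz_ds => [|z ds IH] nz_ds.
    rewrite big_nil; split; first by rewrite size_poly1.
    by apply/polyP=> -[|i]; rewrite coef_poly ?coef1.
  rewrite big_cons mulnS; have -> : ('X - z%:P) * ('X - z^-1%:P)
      = 'X^2 + (- (z + z^-1))%:P * 'X + 1 :> {poly F}.
    have zV1 : z%:P * z^-1%:P = 1 :> {poly F}.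
      by rewrite -polyCM mulfV // nz_ds ?mem_head.
    by rewrite rmorphN rmorphD /=; ring: zV1.
  by apply: palindromicM2; apply: IH => w ws; apply: nz_ds; rewrite inE ws orbT.
have low i : (i <= size ds)%N -> P Q`_i.
  rewrite Q_newton; apply: newton_subfield => r r_bd.
  by rewrite big_cat /= big_map -big_split /=; apply: Pp.
move=> i; have [/low // | lt_di] := leqP i (size ds).
have [le_i|lt_i] := leqP i (2 * size ds); last first.
  rewrite nth_default; first by rewrite -(subrr 1); apply: (subfieldB subP); apply: subfield1.
  by case: Q_pal => sz_Q _; apply: leq_trans sz_Q _.
by rewrite (palindromic_coef Q_pal le_i); apply: low; lia.
Qed.

End PowerSums.

(** * Relations between ratios of variables *)

(** If a i != a j then b i = b j, and a point l with b l != b i would have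
    a l = a i and a l = a j. *)
Lemma grid_lines (T A B : finType) (S : {pred T}) (a : T -> A) (b : T -> B) :
    {in S &, forall i j, i != j -> (a i == a j) (+) (b i == b j)} ->
  {in S &, forall i j, a i = a j} \/ {in S &, forall i j, b i = b j}.
Proof.
move=> ab_xor; have [a_const | a_var] := boolP [forall i in S, forall j in S, a i == a j].
  by left=> i j Si Sj; apply/eqP/(forall_inP (forall_inP a_const i Si)).
right; have [i Si /forall_inPn[j Sj a_ij]] := forall_inPn a_var.
have Dij : i != j by apply: contraNneq a_ij => ->.
have b_ij : b i = b j by have := ab_xor i j Si Sj Dij; rewrite (negPf a_ij) => /eqP.
suff b_i l : l \in S -> b l = b i by move=> l l' Sl Sl'; rewrite !b_i.
move=> Sl; have [-> // | Dli] := eqVneq l i; have [-> // | Dlj] := eqVneq l j.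
apply/eqP/contraT => b_li.
have := ab_xor _ _ Sl Si Dli; have := ab_xor _ _ Sl Sj Dlj.
rewrite -b_ij (negPf b_li) !addbF => /eqP a_lj /eqP a_li.
by rewrite -a_li a_lj eqxx in a_ij.
Qed.

(** The value of a is taken by b nowhere, so b extends to a permutation sending t0
    to it. *)
Lemma perm_extending (T : finType) (t0 : T) (a b : T -> T) :
    (forall i j, i != t0 -> j != t0 -> a i = a j) ->
    (forall i, i != t0 -> a i != b i) ->
    (forall i j, i != t0 -> j != t0 -> i != j -> b i != b j) ->
  exists s : {perm T}, forall i, i != t0 -> a i = s t0 /\ b i = s i.
Proof.
move=> a_const ab b_inj.
have [t1 /= t10 | T1] := pickP (predC1 t0); last first.
  by exists 1%g => i it0; have := T1 i; rewrite /= it0.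
pose h i := if i == t0 then a t1 else b i.
have h_inj : injective h.
  move=> i j; rewrite /h; have [->|it0] := eqVneq i t0; have [->|jt0] := eqVneq j t0 => //.
  - by rewrite (a_const _ _ t10 jt0) => /eqP; rewrite (negPf (ab j jt0)).
  - by rewrite (a_const _ _ t10 it0) => /esym/eqP; rewrite (negPf (ab i it0)).
  by move=> bij; apply/eqP/contraT => /(b_inj i j it0 jt0); rewrite bij eqxx.
exists (perm h_inj) => i it0; rewrite !permE /h eqxx (negPf it0).
by split=> //; apply: a_const.
Qed.

Section Ratios.

Variables (n : nat) (k : fieldType).
Local Notation kX := {fraction {mpoly k[n]}}.
Local Notation X := (@ratX n k).

(** Unique factorization of monomials, read off as equality of exponents. *)
Lemma ratX_prod3 (a b c d e f : 'I_n) :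
    X a * X e * X d = X b * X f * X c ->
  forall i, ((a == i) + (e == i) + (d == i) = (b == i) + (f == i) + (c == i))%N.
Proof.
rewrite /ratX -!rmorphM /= => /eqP; rewrite tofrac_eq -!mpolyXD => /eqP eqm i.
have /eqP : (U_(a) + U_(e) + U_(d) = U_(b) + U_(f) + U_(c))%MM.
  apply/eqP; move/(congr1 (fun p : {mpoly k[n]} => p@_(U_(a) + U_(e) + U_(d)))): eqm.
  rewrite !mcoeffX eqxx eq_sym; case: eqP => // _ /eqP.
  by rewrite oner_eq0.
by move/eqP/mnmP/(_ i); rewrite !mnmDE !mnm1E.
Qed.

(** In the root system of type A, the difference of the roots e_c - e_d and
    e_a - e_b is a root only if the two share their head or their tail, not
    both. *)
Lemma ratX_ratio_xor (a b c d e f : 'I_n) :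
    a != b -> c != d -> e != f -> X a / X b * (X e / X f) = X c / X d ->
  (a == c) (+) (b == d).
Proof.
move=> ab cd ef /eqP; rewrite mulf_div eqr_div ?mulf_neq0 ?ratX_neq0 //.
rewrite [X c * _]mulrC => /eqP/ratX_prod3 H.
have [Eac|Nac] := eqVneq a c; have [Ebd|Nbd] := eqVneq b d => //=.
  by have := H f; rewrite -Eac -Ebd eqxx (negPf ef); lia.
have Efa : f = a.
  have := H a; rewrite eqxx [b == a]eq_sym [c == a]eq_sym (negPf ab) (negPf Nac).
  by case: (f =P a) => //; lia.
by have := H d; rewrite Efa eqxx (negPf Nbd) (negPf cd); lia.
Qed.

(** The points (a i, b i) lie on one line of the grid.  A constant a is the
    case of a permutation s of the variables, X_i0 / X_i |-> X_(s i0) / X_(s i);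
    a constant b is the case of s composed with tau. *)
Lemma ratio_system (i0 : 'I_n) (a b : 'I_n -> 'I_n) :
    (forall i, i != i0 -> a i != b i) ->
    (forall i j, i != i0 -> j != i0 -> i != j -> exists c d,
       c != d /\ X (a i) / X (b i) * (X c / X d) = X (a j) / X (b j)) ->
  exists s : 'S_n,
    (forall i, i != i0 -> a i = s i0 /\ b i = s i) \/
    (forall i, i != i0 -> b i = s i0 /\ a i = s i).
Proof.
move=> ab ab_ratio.
have ab_xor i j : i != i0 -> j != i0 -> i != j -> (a i == a j) (+) (b i == b j).
  move=> ii0 ji0 ij; have [c [d [cd /ratX_ratio_xor->]]] := ab_ratio i j ii0 ji0 ij;
    by rewrite ?ab.
have [a_const|b_const] := @grid_lines _ _ _ (predC1 i0) a b ab_xor.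
  have [|i j ii0 ji0 ij|s sP] := @perm_extending _ i0 a b a_const; last by exists s; left.
    exact: ab.
  by have := ab_xor i j ii0 ji0 ij; rewrite (a_const i j) // eqxx.
have [|i j ii0 ji0 ij|s sP] := @perm_extending _ i0 b a b_const; last by exists s; right.
  by move=> i /ab; rewrite eq_sym.
by have := ab_xor i j ii0 ji0 ij; rewrite (b_const i j) // eqxx addbT.
Qed.

End Ratios.

(** * Invariants of degree zero *)

Section DegreeZero.

Variables (n : nat) (k : fieldType).
Local Notation kX := {fraction {mpoly k[n]}}.
Local Notation X := (@ratX n k).

Lemma ratdeg0_subfield : is_subfield (@ratdeg0 n k).
Proof.
have nzF (p : {mpoly k[n]}) : p != 0 -> tofrac p != 0 by rewrite tofrac_eq0.
split.
- exists 0%N, 1, 1; split; rewrite ?dhomog1 ?oner_eq0 //.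
  by rewrite divff // rmorph1 oner_eq0.
- move=> _ _ [d [p [q [hp hq q0 ->]]]] [e [r [s [hr hs s0 ->]]]].
  exists (d + e)%N, (p * s - q * r), (q * s); split.
  + by rewrite rpredB ?dhomogM.
  + exact: dhomogM.
  + by rewrite mulf_neq0.
  + by rewrite -mulNr addf_div ?nzF // rmorphB !rmorphM mulNr [tofrac r * _]mulrC.
- move=> _ _ [d [p [q [hp hq q0 ->]]]] [e [r [s [hr hs s0 ->]]]].
  exists (d + e)%N, (p * r), (q * s); split; rewrite ?dhomogM ?mulf_neq0 //.
  by rewrite mulf_div !rmorphM.
- move=> _ [d [p [q [hp hq q0 ->]]]]; have [p0|nz_p] := eqVneq p 0.
    exists d, 0, q; split; rewrite ?rpred0 //.
    by rewrite p0 rmorph0 !mul0r invr0.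
  by exists d, q, p; split; rewrite // invf_div.
Qed.

Lemma ratdeg0_ratC c : ratdeg0 (@ratC n k c).
Proof.
exists 0%N, c%:MP, 1; split; rewrite ?dhomog1 ?oner_eq0 //.
  by rewrite -[c%:MP]mulr1 mul_mpolyC rpredZ ?dhomog1.
by rewrite rmorph1 divr1.
Qed.

Lemma ratdeg0_ratio i j : ratdeg0 (X i / X j).
Proof.
exists 1%N, 'X_i, 'X_j; split; rewrite ?dhomogX /= ?mdeg1 //.
by have := ratX_neq0 k j; rewrite tofrac_eq0.
Qed.

Lemma ratdeg0_invP (f : kX) : ratdeg0_inv f <->
  [/\ ratdeg0 f, forall s : 'S_n, perm_act s f = f & tau f = f].
Proof.
split=> [[f0 f_inv]|[f0 f_perm f_tau]]; split=> //.
- by move=> s; apply: (f_inv (s, 0)).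
- by rewrite -{2}(f_inv (1%g, 1)) /= /Gact /= perm_act1.
by move=> [s a]; rewrite /= /Gact /= f_perm; apply: iter_fix.
Qed.

Lemma ratdeg0_inv_subfield : is_subfield (@ratdeg0_inv n k).
Proof.
have d0 := ratdeg0_subfield; split.
- apply/ratdeg0_invP; split; [exact: subfield1 d0 | move=> s |]; exact: rmorph1.
- move=> x y /ratdeg0_invP[x0 xs xt] /ratdeg0_invP[y0 ys yt].
  apply/ratdeg0_invP; split; first exact: (subfieldB d0).
    by move=> s; rewrite rmorphB /= xs ys.
  by rewrite rmorphB /= xt yt.
- move=> x y /ratdeg0_invP[x0 xs xt] /ratdeg0_invP[y0 ys yt].
  apply/ratdeg0_invP; split; first exact: (subfieldM d0).
    by move=> s; rewrite rmorphM /= xs ys.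
  by rewrite rmorphM /= xt yt.
move=> x /ratdeg0_invP[x0 xs xt]; apply/ratdeg0_invP; split.
- exact: (subfieldV d0).
- by move=> s; rewrite fmorphV /= xs.
by rewrite fmorphV /= xt.
Qed.

(** Dividing a form of degree d by X_i0 ^ d gives a polynomial in the X_i / X_i0. *)
Lemma ratdeg0_generated (S : kX -> Prop) (i0 : 'I_n) :
    is_subfield S -> (forall c, S (ratC c)) ->
    (forall i, i != i0 -> S (X i / X i0)) ->
  forall f, ratdeg0 f -> S f.
Proof.
move=> subS S_C S_X.
have SX i : S (X i / X i0).
  have [->|/S_X//] := eqVneq i i0; rewrite divff ?ratX_neq0 //.
  exact: subfield1 subS.
have S_homog d (p : {mpoly k[n]}) : p \is d.-homog -> S (tofrac p / X i0 ^+ d).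
  move=> hp; apply/(in_subfieldP subS).
  rewrite [p]mpolyE raddf_sum mulr_suml big_seq rpred_sum // => m mp.
  rewrite /= -mul_mpolyC tofracM -mulrA rpredM //; first exact/in_subfieldP/S_C.
  rewrite -(dhomog_mf hp mp) mpolyXE_id rmorph_prod /= mdegE -prodrXr -prodf_div.
  rewrite rpred_prod // => i _; rewrite tofracXn -expr_div_n rpredX //.
  exact/in_subfieldP/SX.
move=> _ [d [p [q [hp hq nz_q ->]]]]; have nz_X0 := ratX_neq0 k i0.
have -> : tofrac p / tofrac q = (tofrac p / X i0 ^+ d) / (tofrac q / X i0 ^+ d).
  by rewrite invf_div mulrA divfK ?expf_neq0.
by apply: (subfieldM subS); [|apply: (subfieldV subS)]; apply: S_homog.
Qed.

End DegreeZero.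

(** * The invariants q_r and the polynomial of the ratios *)

Lemma big_ord_pairs (R : Type) (idx : R) (op : Monoid.com_law idx) n
    (F : 'I_n -> 'I_n -> R) :
  \big[op/idx]_i \big[op/idx]_j F i j
  = op (\big[op/idx]_i F i i)
       (\big[op/idx]_(p : 'I_n * 'I_n | (p.1 < p.2)%N) op (F p.1 p.2) (F p.2 p.1)).
Proof.
under eq_bigr => i _ do rewrite (bigD1 i) //= (bigID (fun j : 'I_n => (i < j)%N)) /=.
rewrite !big_split /=; congr (op _ (op _ _)).
  rewrite pair_big_dep /=; apply: eq_bigl => -[i j] /=.
  by rewrite -val_eqE; case: ltngtP.
rewrite (exchange_big_dep predT) //= pair_big_dep /=; apply: eq_bigl => -[i j] /=.
by rewrite -val_eqE; case: ltngtP.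
Qed.

Section Invariants.

Variables (n : nat) (k : fieldType).
Local Notation kX := {fraction {mpoly k[n]}}.
Local Notation X := (@ratX n k).

Lemma q_ratdeg0_inv (r : nat) : ratdeg0_inv (q_ r%:Z : kX).
Proof.
apply/ratdeg0_invP; split.
- apply/(in_subfieldP (ratdeg0_subfield n k)).
  rewrite rpred_sum // => i _; rewrite rpred_sum // => j _.
  by rewrite -exprnP rpredX //; apply/in_subfieldP/ratdeg0_ratio.
- move=> s; rewrite rmorph_sum [RHS](reindex_perm s) /=; apply: eq_bigr => i _.
  rewrite rmorph_sum [RHS](reindex_perm s) /=; apply: eq_bigr => j _.
  by rewrite -!exprnP rmorphXn fmorph_div /= !perm_actX.
rewrite rmorph_sum [RHS]exchange_big; apply: eq_bigr => i _.
rewrite rmorph_sum; apply: eq_bigr => j _.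
by rewrite -!exprnP rmorphXn fmorph_div /= !tauX invrK mulrC.
Qed.

(** One ratio out of each pair of inverse ratios. *)
Definition pair_ratios : seq kX :=
  [seq X p.1 / X p.2 | p <- enum [pred p : 'I_n * 'I_n | (p.1 < p.2)%N]].

Lemma size_pair_ratios : size pair_ratios = (n * (n - 1) %/ 2)%N.
Proof.
rewrite size_map -cardE -sum1_card.
have := @big_ord_pairs _ _ addn n (fun _ _ => 1%N).
rewrite big_split /=; pose c := (\sum_(p : 'I_n * 'I_n | (p.1 < p.2)%N) 1)%N.
rewrite [X in X = (_ %/ _)%N](_ : _ = c) // -/c; move: c => c.
rewrite !sum_nat_const !card_ord !muln1 => En.
have -> : (n * (n - 1) = c * 2)%N by rewrite mulnBr muln1 {1}En addnC addnK muln2 addnn.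
by rewrite mulnK.
Qed.

Definition root_ratios : seq kX := pair_ratios ++ map GRing.inv pair_ratios.

Lemma root_ratiosP (z : kX) :
  reflect (exists a b : 'I_n, a != b /\ z = X a / X b) (z \in root_ratios).
Proof.
apply: (iffP idP).
  rewrite mem_cat => /orP[/mapP[[a b] + ->]|/mapP[_ /mapP[[a b] + ->] ->]];
    rewrite mem_enum inE /= => ab; first by exists a, b; rewrite -val_eqE ltn_eqF.
  by exists b, a; rewrite -val_eqE gtn_eqF // invf_div.
case=> a [b [ab ->]]; rewrite mem_cat; have [lt_ab|lt_ba|/val_inj Eab] := ltngtP a b.
- apply/orP; left; apply/mapP; exists (a, b) => //.
  by rewrite mem_enum inE.
- apply/orP; right; apply/mapP; exists (X b / X a); last by rewrite invf_div.
  by apply/mapP; exists (b, a) => //; rewrite mem_enum inE.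
by rewrite Eab eqxx in ab.
Qed.

Lemma q_pair_ratios (r : nat) :
  q_ r%:Z = n%:R + \sum_(z <- pair_ratios) (z ^+ r + z^-1 ^+ r) :> kX.
Proof.
rewrite /q_ big_ord_pairs /=; congr (_ + _).
  rewrite -[X in X%:R]card_ord -sumr_const; apply: eq_bigr => i _.
  by rewrite divff ?ratX_neq0 // exp1rz.
rewrite big_map -big_enum /=; apply: eq_bigr => p _.
by rewrite invf_div -!exprnP.
Qed.

Lemma prod_root_ratios :
  \prod_(z <- pair_ratios) (('X - z%:P) * ('X - z^-1%:P))
  = \prod_(z <- root_ratios) ('X - z%:P).
Proof. by rewrite /root_ratios big_cat /= big_map big_split. Qed.

(** The elements on which R agrees with sigma form a field. *)
Lemma conj_rmorph_fixed (K : fieldType) (iota : {rmorphism K -> kX})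
    (R : kX -> kX -> Prop) (sigma : {rmorphism kX -> kX}) (i0 : 'I_n) :
    conjugation iota R -> (forall c, R (ratC c) (sigma (ratC c))) ->
    (forall i, i != i0 -> R (X i0 / X i) (sigma (X i0 / X i))) ->
  forall f, ratdeg0 f -> R f (sigma f).
Proof.
move=> cR R_C R_X; apply: (@ratdeg0_generated _ _ (fun u => R u (sigma u)) i0) => //.
  split=> [|u v Ru Rv|u v Ru Rv|u Ru].
  - by have := conj_const cR 1; rewrite !rmorph1.
  - by rewrite rmorphB; apply: (conj_sub cR).
  - by rewrite rmorphM; apply: (conj_mul cR).
  - by rewrite fmorphV; apply: (conj_inv cR).
by move=> i /R_X Ri; rewrite -invf_div fmorphV; apply: (conj_inv cR).
Qed.

(** The conjugation R agrees on the generators X_i0 / X_i with the action of an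
    element of G, hence on all elements of degree 0, and f is fixed by G. *)
Lemma conj_ratdeg0_inv (K : fieldType) (iota : {rmorphism K -> kX})
    (R : kX -> kX -> Prop) (i0 : 'I_n) :
    conjugation iota R -> (forall c, exists c', iota c' = ratC c) ->
    (forall i j, i != j -> exists a b, a != b /\ R (X i / X j) (X a / X b)) ->
  forall f, ratdeg0_inv f -> R f f.
Proof.
move=> cR K_C R_X f /ratdeg0_invP[f0 f_perm f_tau].
have R_C c : R (ratC c) (ratC c) by have [c' <-] := K_C c; apply: conj_const cR c'.
have /fin_all_exists[h hP] (p : 'I_n * 'I_n) : exists u : 'I_n * 'I_n,
    p.1 != p.2 -> u.1 != u.2 /\ R (X p.1 / X p.2) (X u.1 / X u.2).
  have [_|p12] := eqVneq p.1 p.2; first by exists p.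
  by have [a [b ab]] := R_X _ _ p12; exists (a, b).
have hP' i j : i != j -> _ := hP (i, j).
have [i|i j ii0 ji0 ij|s [s_row|s_col]] :=
    @ratio_system n k i0 (fun i => (h (i0, i)).1) (fun i => (h (i0, i)).2).
- by rewrite eq_sym => /hP'[].
- have [cd Rij] := hP' _ _ ij; exists (h (i, j)).1, (h (i, j)).2; split=> //.
  apply: (conj_inj cR (u := X i0 / X j)); last by apply: (hP' i0 j _).2; rewrite eq_sym.
  have -> : X i0 / X j = X i0 / X i * (X i / X j) by rewrite mulrA divfK ?ratX_neq0.
  by apply: (conj_mul cR) => //; apply: (hP' i0 i _).2; rewrite eq_sym.
- rewrite -{2}(f_perm s).
  apply: (@conj_rmorph_fixed _ _ _ (perm_act s) i0 cR) => // [c|i ii0] /=.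
    by rewrite perm_actC.
  rewrite fmorph_div /= !perm_actX; have [<- <-] := s_row i ii0.
  by apply: (hP' i0 i _).2; rewrite eq_sym.
have -> : R f f = R f ((@tau n k \o perm_act s) f) by rewrite /= f_perm f_tau.
apply: (@conj_rmorph_fixed _ _ _ (@tau n k \o perm_act s) i0 cR) => // [c|i ii0] /=.
  by rewrite perm_actC tauC.
rewrite [perm_act _ _]fmorph_div /= !perm_actX fmorph_div /= !tauX invrK [_^-1 * _]mulrC.
have [<- <-] := s_col i ii0.
by apply: (hP' i0 i _).2; rewrite eq_sym.
Qed.

End Invariants.

Theorem theorem2p1 (k : fieldType) (hk : [pchar k] =i pred0)
    (n : nat) (hn : (1 <= n)%N) (f : {fraction {mpoly k[n]}}) :
  ratdeg0_inv f <->
  field_gen ratC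
    (fun g => exists2 r : nat,
       (1 <= r <= (n * (n - 1)) %/ 2)%N & g = q_ r%:Z) f.
Proof.
set S := fun g => _; split=> [f_inv|]; last first.
  apply; first exact: ratdeg0_inv_subfield.
    move=> c; apply/ratdeg0_invP; split=> [|s|]; rewrite ?perm_actC ?tauC //.
    exact: ratdeg0_ratC.
  by move=> _ [r _ ->]; apply: q_ratdeg0_inv.
pose subK := field_gen_subfield ratC S.
pose iota := val : {rmorphism subfield_type subK -> _}.
pose phi : {rmorphism k -> {fraction {mpoly k[n]}}} := @tofrac _ \o @mpolyC n k.
have char0 : [pchar {fraction {mpoly k[n]}}] =i pred0.
  by move=> p; rewrite -hk (fmorph_pchar phi).
have K_C c : field_gen ratC S (ratC c) by move=> L _ L_C _.
have Kp r : (1 <= r <= size (pair_ratios n k))%N ->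
    field_gen ratC S (\sum_(z <- pair_ratios n k) (z ^+ r + z^-1 ^+ r)).
  rewrite size_pair_ratios => r_bd; rewrite -(addKr n%:R (\sum_(z <- _) _)) addrC.
  rewrite -q_pair_ratios; apply: (subfieldB subK).
    by move=> L _ _; apply; exists r.
  by apply/(in_subfieldP subK)/rpred_nat.
have nz_ratios : {in pair_ratios n k, forall z, z != 0}.
  by move=> _ /mapP[p _ ->]; rewrite mulf_neq0 ?invr_eq0 ?ratX_neq0.
have [P DP] := subfield_polyP subK (reciprocal_poly_subfield subK char0 nz_ratios Kp).
have {}DP : map_poly iota P = \prod_(z <- root_ratios n k) ('X - z%:P).
  exact: etrans DP (prod_root_ratios n k).
suff [c ->] : exists c, f = iota c by apply: subfield_valP.
apply: (@galois_descent _ _ iota (root_ratios n k)).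
- by move=> p; rewrite -(fmorph_pchar iota) char0.
- by move=> z zs_z; exists P, (root_ratios n k).
move=> R cR R_roots; have i0 : 'I_n := Ordinal hn.
apply: (conj_ratdeg0_inv i0 cR _ _ f_inv) => [c|i j ij].
  by have /(in_subfieldP subK) Kc := K_C c; exists (Subfield Kc).
have [|v Rv] := R_roots (ratX k i / ratX k j); first by apply/root_ratiosP; exists i, j.
have: root (map_poly iota P) v.
  apply: (conj_root cR Rv); rewrite DP root_prod_XsubC.
  by apply/root_ratiosP; exists i, j.
rewrite DP root_prod_XsubC => /root_ratiosP[a [b [ab Dv]]].
by exists a, b; rewrite -Dv.
Qed.
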